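(* There are infinitely many positive integers $n$ that can be represented as the product of the sum of four positive integers with the sum of their reciprocals, i.e., infinitely many positive integers $n$ for which there exist positive integers $x,y,z,w$ (not necessarily distinct) such that $$n=(x+y+z+w)\left(\frac1x+\frac1y+\frac1z+\frac1w\right).$$ *)

(* Defs.v *)
From mathcomp Require Export all_boot all_order all_algebra.
From mathcomp Require Export classical_sets cardinality.

Set Implicit Arguments.
Unset Strict Implicit.
Unset Printing Implicit Defensive.

Import GRing.Theory.
Local Open Scope ring_scope.

(* The equation is read in [rat], where the reciprocals are genuine. *)
Definition sum_times_recip_sum4 (n : nat) : Prop :=
  exists x y z w : nat,
    [/\ (0 < x)%N, (0 < y)%N, (0 < z)%N, (0 < w)%N &
      n%:R = (x%:R + y%:R + z%:R + w%:R)
             * (x%:R^-1 + y%:R^-1 + z%:R^-1 + w%:R^-1) :> rat].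

(* Main.v *)
(** With [x = y = 1] the expression equals [(2 + z + w) (2 + (z + w) / (z w))],
    which is the integer [2 (z + w) + 12] whenever
    [z^2 + w^2 + 2 z + 2 w = 6 z w].  This equation holds at [(1, 1)] and is
    quadratic in each variable, so Vieta jumping [(z, w) |-> (w, 6 w - 2 - z)]
    produces arbitrarily large solutions. *)
Require Import Defs.
From mathcomp Require Import all_boot all_order all_algebra.
From mathcomp Require Import classical_sets cardinality.
From mathcomp Require Import zify ring lra.

Import GRing.Theory Num.Theory.

Local Open Scope classical_set_scope.

Lemma vieta_solutions_unbounded (N : nat) :
  exists z w : nat, [/\ 0 < z, z <= w, N < w &
    z ^ 2 + w ^ 2 + 2 * z + 2 * w = 6 * z * w].
Proof.
elim: N => [|N [z [w [z_gt0 le_zw lt_Nw zwE]]]]; first by exists 1, 1.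
(* From [0 < z <= w] comes [6 * w - 2 - z >= 5 * w - 2 > w], so the truncated subtraction is exact
   and the larger entry strictly grows. *)
by exists w, (6 * w - 2 - z); split; nia.
Qed.

Lemma sum_times_recip_sum4_vieta (z w : nat) : 0 < z -> 0 < w ->
    z ^ 2 + w ^ 2 + 2 * z + 2 * w = 6 * z * w ->
  sum_times_recip_sum4 (2 * (z + w) + 12).
Proof.
move=> z_gt0 w_gt0 zwE; exists 1, 1, z, w; split=> //.
have z_neq0 : (z%:R != 0 :> rat)%R by rewrite pnatr_eq0 -lt0n.
have w_neq0 : (w%:R != 0 :> rat)%R by rewrite pnatr_eq0 -lt0n.
have {}zwE : (z%:R ^+ 2 + w%:R ^+ 2 + 2 * z%:R + 2 * w%:R
              = 6 * z%:R * w%:R :> rat)%R.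
  by rewrite -!natrX -!natrM -!natrD zwE.
apply: (mulIf (mulf_neq0 z_neq0 w_neq0)).
(* Once expanded, the two sides differ by exactly the two sides of [zwE], so this equality is linear
   in the monomials. *)
transitivity ((z%:R + w%:R + 2) * (2 * z%:R * w%:R + z%:R + w%:R) : rat)%R.
  lra.
by field; rewrite w_neq0 z_neq0.
Qed.

Theorem corollary1p3 :
  infinite_set [set n : nat | (0 < n)%N /\ sum_times_recip_sum4 n].
Proof.
move=> /finite_seqP[s sE].
(* With [w] above the maximum of [s], the value [2 * (z + w) + 12] is too large to lie in [s]. *)
have [z [w [z_gt0 le_zw lt_sw zwE]]] :=
  vieta_solutions_unbounded (\max_(n <- s) n).
have : [set` s] (2 * (z + w) + 12).
  rewrite -sE; split; first by rewrite addn_gt0 orbT.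
  by apply: sum_times_recip_sum4_vieta => //; apply: leq_trans le_zw.
move=> /= s_n; have := @leq_bigmax_seq _ s xpredT id _ s_n isT; lia.
Qed.
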